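(* Let $f:\mathbb{R}\to\mathbb{R}$ be continuously differentiable, and fix $\alpha>0$ and $a\in\mathbb{R}$. Assume that Algorithm S (described in the context) is well-defined for $f$, let $t_0>0$ and $x_0$ be as in Step 1 of Algorithm S for $f$, and let $x^*$ be the global minimizer of $f$ generated by Step 3 of Algorithm S for $f$. Set $g(x):=f(\alpha x-a)$ for $x\in\mathbb{R}$. Then Algorithm S is well-defined for $g$ (with the Steklov function of $f$ replaced by the Steklov function $\widetilde\mu(x,t):=\frac{1}{2t}\int_{x-t}^{x+t}g(\tau)\,d\tau$ of $g$) and generates $z^*:=\frac{x^*+a}{\alpha}$, which is a global minimizer of $g$. In this case, Step 1 for $g$ can be carried out with $s_0:=t_0/\alpha$ in place of $t_0$ and $z_0:=\frac{x_0+a}{\alpha}$ in place of $x_0$.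
   Context: For a continuous function $f:\mathbb{R}\to\mathbb{R}$ the Steklov function is $\mu(x,t):=\frac{1}{2t}\int_{x-t}^{x+t}f(\tau)\,d\tau$, $x\in\mathbb{R}$, $t>0$. Algorithm S, for a function $f$, is the following. Step 1: choose $t_0>0$ large enough so that $\mu(\cdot,t_0)$ is convex, and find the global minimizer $x_0$ of $\mu(\cdot,t_0)$, i.e. solve $f(x_0+t_0)-f(x_0-t_0)=0$ for $x_0$. Step 2: solve the initial value problem $$\dot x(t)=-\frac{f'(x(t)+t)+f'(x(t)-t)}{f'(x(t)+t)-f'(x(t)-t)}\quad\text{for a.e. } t\in(0,t_0],\qquad x(t_0)=x_0.$$ Step 3: report $x^*:=\lim_{t\to0^+}x(t)$ as a global minimizer of $f$. Algorithm S is said to be well-defined for $f$ if there exist $x_0$ and $t_0>0$ such that Steps 1--3 can be carried out: $\mu(\cdot,t_0)$ is convex with global minimizer $x_0$, the initial value problem in Step 2 has a unique solution $x(\cdot)$ on $(0,t_0]$, and the limit in Step 3 exists and is a global minimizer of $f$. A solution is understood as a function on $(0,t_0]$ that is absolutely continuous on compact subintervals and satisfies the equation (with nonzero denominator) for a.e. $t$ and the condition at $t_0$. *)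

(* Defs.v *)
From HB Require Import structures.
From mathcomp Require Import all_boot all_order all_algebra.
From mathcomp Require Import all_classical all_reals all_analysis.
Set Implicit Arguments.
Unset Strict Implicit.
Unset Printing Implicit Defensive.
Import Order.TTheory GRing.Theory Num.Theory.
Import numFieldNormedType.Exports.
Local Open Scope classical_set_scope.
Local Open Scope ring_scope.

Definition continuously_differentiable (R : realType) (f : R -> R) : Prop :=
  (forall x, derivable f x 1) /\ continuous (derive1 f).

Definition steklov (R : realType) (f : R -> R) (x t : R) : R :=
  (2 * t)^-1 * (\int[@lebesgue_measure R]_(tau in `[x - t, x + t]) f tau)%R.

Definition global_minimizer (R : realType) (f : R -> R) (x : R) : Prop :=
  forall y, f x <= f y.

(* The intervals [l i, r i] may share endpoints, so disjointness is only
   required of their interiors. *)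
Definition absolutely_continuous (R : realType) (a b : R) (f : R -> R) : Prop :=
  forall e : R, 0 < e -> exists2 d : R, 0 < d &
    forall (n : nat) (l r : 'I_n -> R),
      (forall i, [/\ a <= l i, l i <= r i & r i <= b]) ->
      trivIset setT (fun i => `]l i, r i[%classic) ->
      (\sum_(i < n) (r i - l i)) < d ->
      (\sum_(i < n) `|f (r i) - f (l i)|) < e.

(* A solution on ]0, t0] is represented by a function on R of which only the
   values on ]0, t0] matter. The two-sided derivative at t0 does depend on the
   other values, but {t0} is Lebesgue-negligible. *)
Definition steklov_ivp_solution (R : realType) (f : R -> R) (t0 x0 : R)
    (x : R -> R) : Prop :=
  [/\ forall a b : R, 0 < a -> a <= b -> b <= t0 -> absolutely_continuous a b x,
      {ae @lebesgue_measure R, forall t, t \in `]0, t0] ->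
         derive1 f (x t + t) - derive1 f (x t - t) != 0 /\
         is_derive t 1 x
           (- ((derive1 f (x t + t) + derive1 f (x t - t)) /
               (derive1 f (x t + t) - derive1 f (x t - t))))}
    & x t0 = x0].

Definition algorithmS_step1 (R : realType) (f : R -> R) (t0 x0 : R) : Prop :=
  [/\ 0 < t0,
      convex_function [set: R^o] (fun x => steklov f x t0)
    & global_minimizer (fun x => steklov f x t0) x0].

Definition algorithmS_step2 (R : realType) (f : R -> R) (t0 x0 : R)
    (x : R -> R) : Prop :=
  steklov_ivp_solution f t0 x0 x /\
  forall y, steklov_ivp_solution f t0 x0 y -> {in `]0, t0], y =1 x}.

Definition algorithmS_step3 (R : realType) (f : R -> R) (x : R -> R)
    (xstar : R) : Prop :=
  x t @[t --> 0^'+] --> xstar /\ global_minimizer f xstar.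

Definition algorithmS_generates (R : realType) (f : R -> R)
    (t0 x0 xstar : R) : Prop :=
  algorithmS_step1 f t0 x0 /\
  exists2 x : R -> R, algorithmS_step2 f t0 x0 x & algorithmS_step3 f x xstar.

Definition algorithmS_well_defined (R : realType) (f : R -> R) : Prop :=
  exists t0 x0 xstar, algorithmS_generates f t0 x0 xstar.

(* Main.v *)
Require Import Defs.
From HB Require Import structures.
From mathcomp Require Import all_boot all_order all_algebra.
From mathcomp Require Import all_classical all_reals all_analysis.
From mathcomp Require Import ring lra.
Set Implicit Arguments.
Unset Strict Implicit.
Unset Printing Implicit Defensive.
Import Order.TTheory GRing.Theory Num.Theory.
Import numFieldNormedType.Exports.
Local Open Scope classical_set_scope.
Local Open Scope ring_scope.

(** Algorithm S commutes with every increasing affine change of variable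
    [u = k * w - c]: each of its three steps is covariant under it.

    - Smoothing. Substituting in the integral, the Steklov function of
      [f (k * _ - c)] at [(z, s)] is the Steklov function of [f] at
      [(k * z - c, k * s)] ([steklov_comp_affine]). Hence the radius [t0]
      becomes [t0 / k], and convexity and minimizers are transported.
    - The initial value problem. If [x] solves it for [f], then
      [s |-> (x (k * s) + c) / k] solves it for [f (k * _ - c)]: in the
      right-hand side all the derivatives get the same factor [k], which cancels
      in the quotient, while on the left the inner factor [k] cancels the outer
      [1 / k] ([steklov_ivp_solution_comp_affine]). The equation holds only
      almost everywhere, and this survives because dilations preserve
      Lebesgue-null sets ([ae_scale]); absolute continuity survives because the
      two moduli are merely rescaled ([absolutely_continuous_affine]).
    - Uniqueness. The inverse change of variable is again increasing and affine,
      so it carries any solution for [f (k * _ - c)] back to a solution for [f],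
      where uniqueness is known.

    The limit at [0^'+] is transported by continuity of affine maps. *)

Lemma is_derive_affine (R : realType) (k c t : R) :
  is_derive t 1 (fun s : R => k * s + c) k.
Proof.
have -> : (fun s : R => k * s + c) = (k \*: id) + cst c by apply/funext.
by apply: is_derive_eq; rewrite /= addr0 [_ *: _]mulr1.
Qed.

Lemma derivable_affine (R : realType) (k c t : R) :
  derivable (fun s : R => k * s + c) t 1.
Proof. by have [] := is_derive_affine k c t. Qed.

Lemma derive1_affine (R : realType) (k c t : R) :
  derive1 (fun s : R => k * s + c) t = k.
Proof.
by rewrite derive1E (@derive_val _ _ _ _ _ _ _ (is_derive_affine k c t)).
Qed.

Lemma continuous_affine (R : realType) (k c : R) :
  continuous (fun s : R => k * s + c).
Proof.
move=> t; apply: differentiable_continuous.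
exact/derivable1_diffP/derivable_affine.
Qed.

Lemma derive1_comp_affine (R : realType) (f : R -> R) (k c t : R) :
  derivable f (k * t + c) 1 ->
  derive1 (fun s => f (k * s + c)) t = k * derive1 f (k * t + c).
Proof.
move=> fd; rewrite (@derive1_comp _ (fun s : R => k * s + c) f)//.
by rewrite derive1_affine mulrC.
Qed.

(** The tolerance [eps] for the new function calls for the tolerance [k * eps]
    for [x], and a total length [dl] of intervals in the variable [k * s] is a
    total length [dl / k] in the variable [s]. *)
Lemma absolutely_continuous_affine (R : realType) (k c b e : R) (x : R -> R) :
  0 < k ->
  absolutely_continuous (k * b) (k * e) x ->
  absolutely_continuous b e (fun s => (x (k * s) + c) / k).
Proof.
move=> k0 acx eps eps0.
have [dl dl0 H] := acx (k * eps) (mulr_gt0 k0 eps0).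
exists (dl / k); first exact: divr_gt0.
move=> n l r lr tI slr.
rewrite (eq_bigr (fun i => k^-1 * `|x (k * r i) - x (k * l i)|)); last first.
  move=> i _; rewrite -mulrBl opprD addrACA subrr addr0 mulrC normrM.
  by rewrite gtr0_norm// invr_gt0.
rewrite -mulr_sumr mulrC ltr_pdivrMr// [eps * k]mulrC.
apply: H.
- by move=> i; have [? ? ?] := lr i; rewrite !ler_pM2l.
- apply/trivIsetP => i j _ _ ij; apply/seteqP; split => // t /=.
  rewrite !in_itv/= => -[/andP[h1 h2] /andP[h3 h4]].
  move/trivIsetP : tI => /(_ i j I I ij)/seteqP[+ _] => /(_ (t / k)); apply.
  by rewrite /= !in_itv/= !ltr_pdivlMr// !ltr_pdivrMr// !(mulrC _ k) h1 h2 h3 h4.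
- rewrite (eq_bigr (fun i => k * (r i - l i))); last by move=> i _; rewrite mulrBr.
  by rewrite -mulr_sumr mulrC -ltr_pdivlMr.
Qed.

(** The right-hand side, as a function of [A], is a measure (a multiple of an
    image measure) that agrees with the Lebesgue measure on the half-open
    intervals, and these determine the Lebesgue measure. *)
Lemma lebesgue_measure_scale (R : realType) (k : R) (A : set R) :
  0 < k -> measurable A ->
  @lebesgue_measure R A =
    (k%:E * @lebesgue_measure R ((fun t : R => (k * t)%R) @^-1` A))%E.
Proof.
move=> k0 mA.
have mf : measurable_fun [set: measurableTypeR R]
    ( *%R k : measurableTypeR R -> measurableTypeR R).
  exact: measurable_realfun.mulrl_measurable.
have := @lebesgue_measure_unique R (mscale (NngNum (ltW k0))
  (pushforward (@lebesgue_measure R) ( *%R k : _ -> measurableTypeR R))).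
move/(_ mf); apply => // _ [[b e] _ <-]/=.
rewrite /mscale /= /pushforward.
have -> : ( *%R k : R -> R) @^-1` `]b, e] = `]b / k, e / k]%classic.
  apply/seteqP; split => t /=; rewrite !in_itv/=;
  by rewrite ltr_pdivrMr// ler_pdivlMr// (mulrC t).
rewrite !lebesgue_measure_itv/= !lte_fin ltr_pM2r ?invr_gt0//.
case: ifPn => _; last by rewrite mule0.
by rewrite -!EFinD -EFinM mulrBr !mulrA ![k * _]mulrC -!mulrA divff ?gt_eqF// !mulr1.
Qed.

Lemma ae_scale (R : realType) (k : R) (P : R -> Prop) :
  0 < k -> {ae @lebesgue_measure R, forall t, P t} ->
  {ae @lebesgue_measure R, forall t, P (k * t)}.
Proof.
move=> k0 [N [mN N0 PN]].
have mf : measurable_fun [set: R] ( *%R k : R -> R).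
  exact: measurable_realfun.mulrl_measurable.
exists ((fun t : R => k * t) @^-1` N); split.
- by rewrite -[X in measurable X]setTI; exact: mf.
- apply/eqP; move/eqP : N0; rewrite (lebesgue_measure_scale k0)// mule_eq0.
  by rewrite eqe gt_eqF.
- by move=> t Pt; exact: PN.
Qed.

(** The Jacobian [k] of the substitution is absorbed by the normalising factor
    [(2 * t)^-1], as the radius [s] becomes [k * s]: averages do not depend on
    the unit of length. *)
Lemma steklov_comp_affine (R : realType) (f : R -> R) (k c z s : R) :
  continuous f -> 0 < k -> 0 < s ->
  steklov (fun x => f (k * x + c)) z s = steklov f (k * z + c) (k * s).
Proof.
move=> cf k0 s0; rewrite /steklov.
pose F t : R := k * t + c.
have dF : derive1 F = cst k by apply/funext => t; exact: derive1_affine.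
have -> : k * z + c - k * s = F (z - s) by rewrite /F; ring.
have -> : k * z + c + k * s = F (z + s) by rewrite /F; ring.
have cF := @continuous_affine R k c.
have -> : \int[@lebesgue_measure R]_(t in `[F (z - s), F (z + s)]) f t =
    \int[@lebesgue_measure R]_(t in `[z - s, z + s]) (k * f (k * t + c)).
  rewrite /Rintegral (@integration_by_substitution_increasing R F f (z - s) (z + s)).
  - by congr fine; apply: eq_integral => t _; rewrite dF /= mulrC.
  - lra.
  - by move=> x y _ _ xy; rewrite /F ltrD2r ltr_pM2l.
  - by rewrite dF => t _; exact: cst_continuous.
  - by rewrite dF; exact: is_cvg_cst.
  - by rewrite dF; exact: is_cvg_cst.
  - split => [t _||].
    + exact: derivable_affine.
    + by apply: cvg_at_right_filter; exact: cF.
    + by apply: cvg_at_left_filter; exact: cF.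
  - exact: continuous_subspaceT.
rewrite RintegralZl//; last first.
  apply: continuous_compact_integrable; first exact: segment_compact.
  apply: continuous_subspaceT => t.
  by apply: (@continuous_comp _ _ _ F f); [exact: cF|exact: cf].
rewrite [RHS]mulrA; congr (_ * _).
by field; rewrite !gt_eqF.
Qed.

(** At a time [s] the transported curve satisfies
    [k * ((x (k * s) + c) / k +/- s) - c = x (k * s) +/- k * s], so both sides of
    its equation are those of the equation for [x] at time [k * s]. *)
Lemma steklov_ivp_solution_comp_affine (R : realType) (f : R -> R)
    (k c t0 x0 : R) (x : R -> R) :
  (forall u, derivable f u 1) -> 0 < k ->
  steklov_ivp_solution f t0 x0 x ->
  steklov_ivp_solution (fun u => f (k * u - c)) (t0 / k) ((x0 + c) / k)
    (fun s => (x (k * s) + c) / k).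
Proof.
move=> df k0 [acx aex xt0]; split.
- move=> b e b0 be et0; apply: absolutely_continuous_affine => //.
  by apply: acx; rewrite ?mulr_gt0 ?ler_pM2l// mulrC -ler_pdivlMr.
- have ae_filter := ae_filter_ringOfSetsType (@lebesgue_measure R).
  apply: filterS (ae_scale k0 aex) => s H /[!in_itv]/= /andP[s0 st0].
  have kn0 : k != 0 by rewrite gt_eqF.
  have /H[] : k * s \in `]0, t0].
    by rewrite in_itv/= mulr_gt0//= mulrC -ler_pdivlMr.
  have E u : derive1 (fun u => f (k * u - c)) u = k * derive1 f (k * u - c).
    exact: derive1_comp_affine.
  rewrite !E.
  have -> : k * ((x (k * s) + c) / k + s) - c = x (k * s) + k * s by field.
  have -> : k * ((x (k * s) + c) / k - s) - c = x (k * s) - k * s by field.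
  set p := derive1 f _; set q := derive1 f _ => pq dx.
  rewrite -mulrBr mulf_neq0//; split => //.
  have -> : (fun s => (x (k * s) + c) / k) =
      (fun u => k^-1 * u + c / k) \o (x \o (fun u => k * u + 0)).
    by apply/funext => u /=; rewrite addr0 mulrDl (mulrC k^-1).
  have dx' : is_derive (k * s + 0) 1 x (- ((p + q) / (p - q))) by rewrite addr0.
  have dcomp := is_derive1_comp (is_derive_affine k^-1 (c / k) _)
    (@is_derive1_comp _ x (fun u => k * u + 0) s _ _ dx' (is_derive_affine k 0 s)).
  apply: (is_derive_eq dcomp).
  by rewrite -mulrDr; field; rewrite kn0 pq.
- by rewrite mulrCA divff ?gt_eqF// mulr1 xt0.
Qed.

Lemma convex_function_comp_affine (R : realType) (h : R -> R) (k c : R) :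
  convex_function [set: R^o] h ->
  convex_function [set: R^o] (fun z => h (k * z + c)).
Proof.
move=> hc t u v _ _.
have := hc t (k * u + c) (k * v + c) (in_setT _) (in_setT _).
apply: le_trans; rewrite le_eqVlt; apply/orP; left; apply/eqP; congr h.
by rewrite /conv /= /unstable.onem /GRing.scale /=; ring.
Qed.

Lemma global_minimizer_comp_affine (R : realType) (h : R -> R) (k c x : R) :
  0 < k -> global_minimizer h x ->
  global_minimizer (fun z => h (k * z - c)) ((x + c) / k).
Proof.
move=> k0 hx z /=.
suff -> : k * ((x + c) / k) - c = x by exact: hx.
by rewrite mulrC divfK ?addrK// gt_eqF.
Qed.

Lemma algorithmS_generates_comp_affine (R : realType) (f : R -> R)
    (k c t0 x0 xstar : R) :
  (forall u, derivable f u 1) -> 0 < k ->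
  algorithmS_generates f t0 x0 xstar ->
  algorithmS_generates (fun u => f (k * u - c))
    (t0 / k) ((x0 + c) / k) ((xstar + c) / k).
Proof.
move=> df k0 [[t00 fconv fmin] [x [xsol xuniq] [xlim xmin]]].
have kn0 : k != 0 by rewrite gt_eqF.
have cf : continuous f.
  by move=> u; apply: differentiable_continuous; exact/derivable1_diffP.
have mu_g : (fun z => steklov (fun u => f (k * u - c)) z (t0 / k)) =
    (fun z => steklov f (k * z - c) t0).
  apply/funext => z; rewrite steklov_comp_affine ?divr_gt0//.
  by rewrite mulrCA divff// mulr1.
split; [split; rewrite ?mu_g|].
- exact: divr_gt0.
- exact: (@convex_function_comp_affine _ (fun z => steklov f z t0)).
- exact: (@global_minimizer_comp_affine _ (fun z => steklov f z t0)).
exists (fun s => (x (k * s) + c) / k); split.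
- exact: steklov_ivp_solution_comp_affine.
- move=> y ysol s; rewrite in_itv/= => /andP[s0 st0].
  (* [y] is carried back to a solution for [f] by the inverse change of
     variable [u = k^-1 * w - (- c / k)], and compared there with [x] *)
  pose g u := f (k * u - c).
  have dg u : derivable g u 1.
    apply/derivable1_diffP; apply: (@differentiable_comp _ _ _ _ (fun u => k * u - c) f).
      exact/derivable1_diffP/derivable_affine.
    exact/derivable1_diffP.
  have ki0 : 0 < k^-1 by rewrite invr_gt0.
  have := steklov_ivp_solution_comp_affine (- c / k) dg ki0 ysol.
  have -> : (fun u => g (k^-1 * u - (- c / k))) = f.
    by apply/funext => u; rewrite /g; congr f; field.
  have -> : t0 / k / k^-1 = t0 by field.
  have -> : ((x0 + c) / k + - c / k) / k^-1 = x0 by field.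
  move=> /xuniq /(_ (k * s)) <-; last first.
    by rewrite in_itv/= mulr_gt0//= mulrC -ler_pdivlMr.
  by rewrite mulKf//; field.
- apply: cvgMl; apply: cvgD; last exact: cvg_cst.
  apply: (@increasing_cvg_at_right_comp _ (fun s => k * s) x 0 +oo%O) => //=.
  + by move=> u v _ _ uv; rewrite ltr_pM2l.
  + apply: cvg_at_right_filter; exact: mulrl_continuous.
  + by rewrite mulr0.
- exact: global_minimizer_comp_affine.
Qed.

Theorem lemma2 (R : realType) (f : R -> R) (alpha a t0 x0 xstar : R)
  (f_C1 : continuously_differentiable f) (alpha_gt0 : 0 < alpha)
  (f_wd : algorithmS_well_defined f)
  (f_gen : algorithmS_generates f t0 x0 xstar) :
  let g := fun x : R => f (alpha * x - a) in
  let s0 := t0 / alpha in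
  let z0 := (x0 + a) / alpha in
  let zstar := (xstar + a) / alpha in
  [/\ algorithmS_well_defined g,
      algorithmS_step1 g s0 z0,
      algorithmS_generates g s0 z0 zstar
    & global_minimizer g zstar].
Proof.
move=> g s0 z0 zstar.
have g_gen : algorithmS_generates g s0 z0 zstar.
  exact: (algorithmS_generates_comp_affine a f_C1.1).
split=> //; first by exists s0, z0, zstar.
- by case: g_gen.
- by case: g_gen => _ [? _ []].
Qed.
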